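(* Let $(M,g)$ be an $n$-dimensional Riemannian manifold, $p\in M$, $U_p$ a normal geodesic neighborhood of $p$, $0<\lambda<1$, and let $E$ be a vector bundle over $M$ of finite rank equipped with an affine connection. Let $P\in\mathrm{Diff}(M,E)$ be a differential operator of order $m$ which is geometric with respect to the metric $g$. Then the differential operator $\mathfrak f_\lambda^\sharp P$, of order $m$, is geometric with respect to the metric $g_\lambda:=\lambda^{-2}\mathfrak f_\lambda^*g$.
   Context: **Coordinates.** Fix an orthonormal basis $e_1(p),\dots,e_n(p)$ of $(T_pM,g)$ and $U_p=\exp_p(B_r)$ with normal geodesic coordinates $x=(x^1,\dots,x^n)\leftrightarrow\exp_p(\sum_ix^ie_i(p))$. $\mathfrak f_\lambda:U_p\to\exp_p(B_{\lambda r})$ is $x\mapsto\lambda x$. The metric $g_\lambda=\lambda^{-2}\mathfrak f_\lambda^*g$ on $U_p$ has $(g_\lambda)_{ij}(x)=g_{ij}(\lambda x)$, agrees with $g$ at $p$, and has the same normal coordinates $x^i$ at $p$. **Vielbeins.** For a metric $h\in\{g,g_\lambda\}$ let $e_1(\cdot,h),\dots,e_n(\cdot,h)$ be the $h$-orthonormal frame on $U_p$ obtained from $(e_i(p))$ by $h$-Levi-Civita parallel transport along the geodesics from $p$, and define $a_i^l(\cdot,h)$, $b_l^i(\cdot,h)$ by $\partial_{x^i}=\sum_la_i^l(\cdot,h)e_l(\cdot,h)$, $e_l(\cdot,h)=\sum_jb_l^j(\cdot,h)\partial_{x^j}$. **Geometric operators.** $D^\gamma$ is the coordinate partial derivative with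 multi-index $\gamma$. $E$ is trivialised over $U_p$ by the frame $s_1(\cdot,g),\dots,s_k(\cdot,g)$ obtained by parallel transport of a fixed basis of $E_p$ along geodesics from $p$; $D^\gamma$ acts componentwise and $P=\sum_{|\gamma|\le m}P_\gamma D^\gamma$, $P_\gamma(x)\in\mathrm{End}(E_x)$. A geometric polynomial of Gilkey order $N$ with respect to $h$ is a constant-coefficient linear combination of finite products of factors $D^\beta a_i^t(\cdot,h)$ and $D^\delta b_n^l(\cdot,h)$ whose orders of differentiation add up to $N$ in each product. $P$ of order $m$ is geometric with respect to $h$ if for every $\gamma$ the matrix entries of $P_\gamma$ in the parallel frame are geometric polynomials of Gilkey order $m-|\gamma|$ with respect to $h$. **Pull-back.** $(\mathfrak f_\lambda^\sharp P)s=P(s\circ\mathfrak f_\lambda^{-1})\circ\mathfrak f_\lambda$ for sections $s$ of the pull-back bundle $\mathfrak f_\lambda^*E$ over $U_p$; $\mathfrak f_\lambda^*E$ is equipped with the pulled-back connection, and its parallel frame relative to $g_\lambda$ along geodesics from $p$ is $s_j(\mathfrak f_\lambda(\cdot),g)$. *)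

(* Defs.v *)
From HB Require Import structures.
From mathcomp Require Import all_boot all_order all_algebra.
From mathcomp Require Import all_classical all_reals all_analysis.
Import Order.TTheory GRing.Theory Num.Theory numFieldNormedType.Exports.

Set Implicit Arguments.
Unset Strict Implicit.
Unset Printing Implicit Defensive.

Local Open Scope classical_set_scope.
Local Open Scope ring_scope.

(* Points and vectors of R^n are row vectors; matrices act on the right.  In  *)
(* particular ('J F x) i j is the i-th partial derivative of the j-th         *)
(* component of F, and a frame of n vectors is the matrix of its rows.        *)

Section Calculus.
Variables (R : realType) (n : nat).
Implicit Types (f : 'rV[R]_n -> R) (x v : 'rV[R]_n).

Definition partial (i : 'I_n) f : 'rV[R]_n -> R :=
  fun x => 'D_(delta_mx 0 i) f x.

Definition partials (s : seq 'I_n) f : 'rV[R]_n -> R := foldr partial f s.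

(* D^gamma f *)
Definition Dmulti (gamma : 'I_n -> nat) f : 'rV[R]_n -> R :=
  foldr (fun i h => iter (gamma i) (partial i) h) f (enum 'I_n).

Definition mdeg (gamma : 'I_n -> nat) : nat := (\sum_i gamma i)%N.

(* C^infinity on W (only used for open W) *)
Definition smooth_on (W : set 'rV[R]_n) f : Prop :=
  forall (s : seq 'I_n) x, W x -> differentiable (partials s f) x.

Definition smooth_mx_on (W : set 'rV[R]_n) a b (F : 'rV[R]_n -> 'M[R]_(a, b)) :
  Prop := forall i j, smooth_on W (fun x => F x i j).

(* The library norm on 'rV[R]_n is the sup norm, hence this definition. *)
Definition eball (r : R) : set 'rV[R]_n :=
  [set x | \sum_i (x 0 i) ^+ 2 < r ^+ 2].

(* (\sum_{|gamma| <= m} P_gamma D^gamma u)(x) for a vector-valued u; a        *)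
(* multi-index with |gamma| <= m has all its entries in 'I_m.+1.              *)
Definition diff_expr (m k : nat)
    (coef : {ffun 'I_n -> 'I_m.+1} -> 'rV[R]_n -> 'M[R]_k)
    (u : 'rV[R]_n -> 'rV[R]_k) x : 'rV[R]_k :=
  \sum_(gamma : {ffun 'I_n -> 'I_m.+1} |
      (mdeg (fun i => gamma i) <= m)%N)
    (\row_a Dmulti (fun i => gamma i) (fun y => u y 0 a) x) *m coef gamma x.

End Calculus.

Section Manifolds.
Variables (R : realType) (n : nat).

(* cmap is the chart on the open set cdom and cinv its inverse; their values  *)
(* elsewhere are irrelevant.                                                  *)
Record chart (T : Type) := Chart {
  cdom : set T;
  cmap : T -> 'rV[R]_n;
  cinv : 'rV[R]_n -> T }.

Definition is_chart (T : topologicalType) (c : chart T) : Prop :=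
  [/\ open (cdom c), open (cmap c @` cdom c),
      forall q, cdom c q -> cinv c (cmap c q) = q,
      forall q, cdom c q -> {for q, continuous (cmap c)} &
      forall x, (cmap c @` cdom c) x -> {for x, continuous (cinv c)}].

Definition chart_change (T : Type) (c c' : chart T) : 'rV[R]_n -> 'rV[R]_n :=
  cmap c' \o cinv c.

Definition compatible (T : Type) (c c' : chart T) : Prop :=
  smooth_mx_on (cmap c @` (cdom c `&` cdom c')) (chart_change c c') /\
  smooth_mx_on (cmap c' @` (cdom c `&` cdom c')) (chart_change c' c).

Record manifold := Manifold {
  carrier :> topologicalType;
  carrier_hausdorff : hausdorff_space carrier;
  carrier_countable : @second_countable carrier;
  atlas : set (chart carrier);
  atlas_chart : forall c, atlas c -> is_chart c;
  atlas_cover : forall q : carrier, exists2 c, atlas c & cdom c q;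
  atlas_compatible : forall c c', atlas c -> atlas c' -> compatible c c';
  atlas_maximal : forall c, is_chart c ->
    (forall c', atlas c' -> compatible c c') -> atlas c }.

End Manifolds.
Arguments atlas {R n} m c.

Section Metrics.
Variables (R : realType) (n : nat) (M : manifold R n).

Definition smooth_fun (W : set M) (f : M -> R) : Prop :=
  forall c, atlas M c -> smooth_on (cmap c @` (cdom c `&` W)) (f \o cinv c).

(* gram c is the matrix (g_ij) in the chart c *)
Record riemannian_metric := RiemannianMetric {
  gram : chart R n M -> 'rV[R]_n -> 'M[R]_n;
  gram_smooth : forall c, atlas M c ->
    smooth_mx_on (cmap c @` cdom c) (gram c);
  gram_sym : forall c x, atlas M c -> (cmap c @` cdom c) x ->
    (gram c x)^T = gram c x;
  gram_pos : forall c x, atlas M c -> (cmap c @` cdom c) x ->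
    forall v : 'rV[R]_n, v != 0 -> 0 < (v *m gram c x *m v^T) 0 0;
  gram_change : forall c c' q, atlas M c -> atlas M c' ->
    cdom c q -> cdom c' q ->
    let J := 'J (chart_change c c') (cmap c q) in
    gram c (cmap c q) = J *m gram c' (cmap c' q) *m J^T }.

End Metrics.

(* h : 'rV_n -> 'M_n is the matrix of a metric in given coordinates *)
Section CoordinateMetric.
Variables (R : realType) (n : nat) (h : 'rV[R]_n -> 'M[R]_n).

(* Gamma^k_ij *)
Definition christoffel (k i j : 'I_n) (x : 'rV[R]_n) : R :=
  2^-1 * \sum_l (invmx (h x)) k l *
    (partial i (fun y => h y j l) x + partial j (fun y => h y i l) x
     - partial l (fun y => h y i j) x).

Definition geodesic (I : set R) (c : R -> 'rV[R]_n) : Prop :=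
  forall t k, I t ->
  let c_ i := fun s : R => c s 0 i in
  [/\ derivable (c_ k) t 1, derivable (derive1 (c_ k)) t 1 &
      derive1 (derive1 (c_ k)) t + \sum_i \sum_j
        christoffel k i j (c t) * derive1 (c_ i) t * derive1 (c_ j) t = 0].

(* Levi-Civita parallel vector field X along the curve c *)
Definition parallel_vector (I : set R) (c X : R -> 'rV[R]_n) : Prop :=
  forall t k, I t ->
  derivable (fun s : R => X s 0 k) t 1 /\
  derive1 (fun s : R => X s 0 k) t + \sum_i \sum_j
    christoffel k i j (c t) * derive1 (fun s : R => c s 0 i) t * X t 0 j = 0.

(* B x l j = b_l^j(x), i.e. row l of B x is e_l(x, h).  The coordinates are   *)
(* meant to be normal for h, so that the geodesics from p are the rays.       *)
Definition vielbein (r : R) (B : 'rV[R]_n -> 'M[R]_n) : Prop :=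
  [/\ smooth_mx_on (eball r) B, B 0 = 1%:M,
      forall x, eball r x -> B x *m h x *m (B x)^T = 1%:M &
      forall (l : 'I_n) (v : 'rV[R]_n),
        parallel_vector [set t | eball r (t *: v)]
          (fun t => t *: v) (fun t => row l (B (t *: v)))].

End CoordinateMetric.

Section GeometricPolynomials.
Variables (R : realType) (n : nat).

(* Dvb beta i t stands for D^beta a_i^t, Dvbinv delta l j for D^delta b_l^j *)
Inductive gfactor :=
  | Dvb of 'I_n -> nat & 'I_n & 'I_n
  | Dvbinv of 'I_n -> nat & 'I_n & 'I_n.

Definition gfactor_order (w : gfactor) : nat :=
  match w with Dvb beta _ _ => mdeg beta | Dvbinv delta _ _ => mdeg delta end.

(* \partial_i = \sum_l a_i^l e_l and e_l = \sum_j b_l^j \partial_j, whence    *)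
(* (a_i^l) = (b_l^j)^-1.                                                      *)
Definition gfactor_eval (B : 'rV[R]_n -> 'M[R]_n) (w : gfactor) :
    'rV[R]_n -> R :=
  match w with
  | Dvb beta i t => Dmulti beta (fun y => invmx (B y) i t)
  | Dvbinv delta l j => Dmulti delta (fun y => B y l j)
  end.

Definition geometric_polynomial (r : R) (B : 'rV[R]_n -> 'M[R]_n) (N : nat)
    (f : 'rV[R]_n -> R) : Prop :=
  exists Q : seq (R * seq gfactor),
    all (fun q => (\sum_(w <- q.2) gfactor_order w)%N == N) Q /\
    (forall x, eball r x ->
       f x = \sum_(q <- Q) q.1 * \prod_(w <- q.2) gfactor_eval B w x).

End GeometricPolynomials.

Section Bundles.
Variables (R : realType) (n k : nat) (M : manifold R n).

Record trivialization (T : Type) := Trivialization {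
  tdom : set M;
  tcoord : T -> 'rV[R]_k;
  tincl : M -> 'rV[R]_k -> T }.

(* rows: the frame of t expressed in the frame of t' *)
Definition transition (T : Type) (t t' : trivialization T) (q : M) : 'M[R]_k :=
  \matrix_(a < k) tcoord t' (tincl t q (delta_mx 0 a)).

(* Linear structure of the fibres and smooth structure of the total space are *)
(* the ones transported by the trivializations.                               *)
Record vbundle := VBundle {
  total :> Type;
  bproj : total -> M;
  trivs : set (trivialization total);
  triv_open : forall t, trivs t -> open (tdom t);
  triv_cover : forall q, exists2 t, trivs t & tdom t q;
  triv_proj : forall t q v, trivs t -> tdom t q -> bproj (tincl t q v) = q;
  triv_inclK : forall t q v, trivs t -> tdom t q -> tcoord t (tincl t q v) = v;
  triv_coordK : forall t e, trivs t -> tdom t (bproj e) ->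
    tincl t (bproj e) (tcoord t e) = e;
  triv_linear : forall t t' q v, trivs t -> trivs t' -> tdom t q -> tdom t' q ->
    tcoord t' (tincl t q v) = v *m transition t t' q;
  triv_smooth : forall t t', trivs t -> trivs t' ->
    forall a b, smooth_fun (tdom t `&` tdom t') (fun q => transition t t' q a b)
}.

Variable E : vbundle.

(* cform t c x i is the connection matrix omega_i at the point of coordinates *)
(* x: in the frame (s_a) of t, nabla_i s_a = \sum_b (omega_i)_ab s_b.         *)
Record connection := Connection {
  cform : trivialization E -> chart R n M -> 'rV[R]_n -> 'I_n -> 'M[R]_k;
  cform_smooth : forall t c i, trivs t -> atlas M c ->
    smooth_mx_on (cmap c @` (cdom c `&` tdom t)) (fun x => cform t c x i);
  cform_change_triv : forall t t' c q i, trivs t -> trivs t' -> atlas M c ->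
    cdom c q -> tdom t q -> tdom t' q ->
    let x := cmap c q in
    cform t c x i *m transition t t' q =
    \matrix_(a, b) partial i (fun y => transition t t' (cinv c y) a b) x
    + transition t t' q *m cform t' c x i;
  cform_change_chart : forall t c c' q i, trivs t -> atlas M c -> atlas M c' ->
    cdom c q -> cdom c' q -> tdom t q ->
    cform t c (cmap c q) i =
    \sum_j ('J (chart_change c c') (cmap c q)) i j *: cform t c' (cmap c' q) j
}.

(* Sections of f^*E, for f : M -> M, are maps s : M -> E lying over f; those  *)
(* of E are the case f = id.  A section over an open set O is represented by  *)
(* a map on all of M whose values outside O are irrelevant.                   *)
Definition smooth_section (f : M -> M) (O : set M) (s : M -> E) : Prop :=
  (forall q, O q -> bproj (s q) = f q) /\
  forall t, trivs t -> forall a,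
    smooth_fun (O `&` f @^-1` tdom t) (fun q => tcoord t (s q) 0 a).

(* Q is a differential operator of order (at most) m on f^*E over W, in terms *)
(* of the charts of M and the trivializations of f^*E pulled back from E.     *)
(* It acts on sections over every open subset of W.                           *)
Definition diff_operator (f : M -> M) (W : set M) (m : nat)
    (Q : (M -> E) -> (M -> E)) : Prop :=
  (forall O s, open O -> O `<=` W -> smooth_section f O s ->
     forall q, O q -> bproj (Q s q) = f q) /\
  forall c t, atlas M c -> trivs t ->
  exists coef : {ffun 'I_n -> 'I_m.+1} -> 'rV[R]_n -> 'M[R]_k,
    (forall gamma,
       smooth_mx_on (cmap c @` (cdom c `&` (W `&` f @^-1` tdom t)))
         (coef gamma)) /\
    (forall O s, open O -> O `<=` W -> smooth_section f O s ->
     forall q, O q -> cdom c q -> tdom t (f q) ->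
       tcoord t (Q s q) =
       diff_expr coef (fun y => tcoord t (s (cinv c y))) (cmap c q)).

(* e = \sum_j u_j s_j(q) in the fibre of f^*E at q *)
Definition has_components (f : M -> M) (s : 'I_k -> M -> E) (q : M) (e : E)
    (u : 'rV[R]_k) : Prop :=
  bproj e = f q /\
  forall t, trivs t -> tdom t (f q) ->
    tcoord t e = u *m \matrix_(j < k) tcoord t (s j q).

Definition fibre_basis (q : M) (b : 'I_k -> E) : Prop :=
  (forall j, bproj (b j) = q) /\
  forall t, trivs t -> tdom t q -> \matrix_(j < k) tcoord t (b j) \in unitmx.

Definition coord_rep (c : chart R n M) (f : M -> M) : 'rV[R]_n -> 'rV[R]_n :=
  cmap c \o f \o cinv c.

(* connection form of f^* nabla in the pulled back trivialization, for f      *)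
(* mapping cdom c to itself                                                   *)
Definition pullback_cform (nabla : connection) (c : chart R n M) (f : M -> M)
    (t : trivialization E) (x : 'rV[R]_n) (i : 'I_n) : 'M[R]_k :=
  \sum_j ('J (coord_rep c f) x) i j *: cform nabla t c (coord_rep c f x) j.

(* u is a section of f^*E along the curve of coordinates g, parallel for the  *)
(* pulled back connection                                                     *)
Definition parallel_section (nabla : connection) (c : chart R n M) (f : M -> M)
    (I : set R) (g : R -> 'rV[R]_n) (u : R -> E) : Prop :=
  forall s, I s -> forall t, trivs t -> tdom t (f (cinv c (g s))) ->
  forall b,
    derivable (fun s' : R => tcoord t (u s') 0 b) s 1 /\
    derive1 (fun s' : R => tcoord t (u s') 0 b) s
    + \sum_i derive1 (fun s' : R => g s' 0 i) s *
        (tcoord t (u s) *m pullback_cform nabla c f t (g s) i) 0 b = 0.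

(* The frame of f^*E over cdom c obtained from the basis s0 of its fibre at p *)
(* by parallel transport along the rays from p; c is a normal chart at p of   *)
(* radius r.                                                                  *)
Definition parallel_frame (nabla : connection) (c : chart R n M) (r : R)
    (p : M) (f : M -> M) (s0 : 'I_k -> E) (s : 'I_k -> M -> E) : Prop :=
  [/\ forall j, smooth_section f (cdom c) (s j),
      forall j, s j p = s0 j,
      forall q, cdom c q -> fibre_basis (f q) (fun j => s j q) &
      forall j (v : 'rV[R]_n),
        parallel_section nabla c f [set a | eball r (a *: v)]
          (fun a => a *: v) (fun a => s j (cinv c (a *: v)))].

(* c is a normal geodesic chart at p, of radius r, for the metric on cdom c   *)
(* whose matrix in c is h: rays are geodesics, i.e. cinv c x =                *)
(* exp_p (\sum_i x_i e_i(p)) with the orthonormal basis e_i(p) = \partial_i.  *)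
Definition normal_chart (c : chart R n M) (p : M) (r : R)
    (h : 'rV[R]_n -> 'M[R]_n) : Prop :=
  [/\ atlas M c /\ 0 < r, cdom c p /\ cmap c p = 0, cmap c @` cdom c = eball r,
      h 0 = 1%:M &
      forall v : 'rV[R]_n,
        geodesic h [set t | eball r (t *: v)] (fun t => t *: v)].

(* The operator Q of order m on f^*E over the normal neighbourhood cdom c is  *)
(* geometric with respect to h.  Vielbein and parallel frame exist and are    *)
(* unique on cdom c (linear ODE along the rays), so "exists" means "the".     *)
Definition geometric_operator (nabla : connection) (c : chart R n M) (p : M)
    (r : R) (f : M -> M) (s0 : 'I_k -> E) (h : 'rV[R]_n -> 'M[R]_n) (m : nat)
    (Q : (M -> E) -> (M -> E)) : Prop :=
  normal_chart c p r h /\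
  exists (B : 'rV[R]_n -> 'M[R]_n) (s : 'I_k -> M -> E)
         (coef : {ffun 'I_n -> 'I_m.+1} -> 'rV[R]_n -> 'M[R]_k),
  [/\ vielbein h r B, parallel_frame nabla c r p f s0 s,
      forall gamma : {ffun 'I_n -> 'I_m.+1},
        (mdeg (fun i => gamma i) <= m)%N -> forall a b,
        geometric_polynomial r B (m - mdeg (fun i => gamma i))%N
          (fun x => coef gamma x a b) &
      forall O sigma (u : 'rV[R]_n -> 'rV[R]_k),
        open O -> O `<=` cdom c -> smooth_section f O sigma ->
        (forall q, O q -> has_components f s q (sigma q) (u (cmap c q))) ->
        forall q, O q ->
          has_components f s q (Q sigma q) (diff_expr coef u (cmap c q))].

(* f_lambda, in the normal chart c; its inverse is dilation c lambda^-1 *)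
Definition dilation (c : chart R n M) (lambda : R) : M -> M :=
  fun q => cinv c (lambda *: cmap c q).

Definition pullback_operator (c : chart R n M) (lambda : R)
    (P : (M -> E) -> (M -> E)) : (M -> E) -> (M -> E) :=
  fun s => P (s \o dilation c lambda^-1) \o dilation c lambda.

(* matrix of f^*g in the chart c, for f mapping cdom c to itself *)
Definition pullback_gram (g : riemannian_metric M) (c : chart R n M)
    (f : M -> M) (x : 'rV[R]_n) : 'M[R]_n :=
  'J (coord_rep c f) x *m gram g c (coord_rep c f x)
    *m ('J (coord_rep c f) x)^T.

Definition rescaled_gram (g : riemannian_metric M) (c : chart R n M)
    (lambda : R) (x : 'rV[R]_n) : 'M[R]_n :=
  lambda ^- 2 *: pullback_gram g c (dilation c lambda) x.

End Bundles.

(* Main.v *)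
(* If e_l(., g) has matrix B in the normal coordinates, then e_l(., g_lambda) *)
(* has matrix x |-> B (lambda x), because the Christoffel symbols of g_lambda *)
(* are lambda Gamma (lambda x).  Hence every factor D^beta of a vielbein      *)
(* coefficient picks up lambda^|beta|, and a geometric polynomial of Gilkey   *)
(* order N evaluated at lambda x is lambda^-N times one of g_lambda at x.     *)
(* By the chain rule the coefficients of the pulled back operator are         *)
(* lambda^-|gamma| P_gamma (lambda x), so they are geometric with the overall *)
(* factor lambda^-m.                                                          *)
Require Import Defs.
From HB Require Import structures.
From mathcomp Require Import all_boot all_order all_algebra.
From mathcomp Require Import all_classical all_reals all_analysis.
Import Order.TTheory GRing.Theory Num.Theory numFieldNormedType.Exports.
Set Implicit Arguments.
Unset Strict Implicit.
Unset Printing Implicit Defensive.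

Local Open Scope classical_set_scope.
Local Open Scope ring_scope.

(** In the normal coordinates of g the dilation is x |-> lambda x, so g_lambda has the matrix of g
    at lambda x ([rescaled_gram_scale]), and rays stay geodesics ([normal_chart_scale]). Parallel
    transport along the ray t v, for g_lambda or for the pulled back connection, is the original
    transport along t (lambda v): the factor lambda of the Christoffel symbols or of the connection
    form is the one in the velocity lambda v ([vielbein_scale], [parallel_frame_pullback]). All
    monomials of Gilkey order m - |gamma| therefore scale by the same power of lambda
    ([geometric_polynomial_scale]), the chain rule contributes lambda^-|gamma| ([diff_expr_scale]),
    and the constant lambda^-m left over is absorbed into the coefficients of the polynomial. That
    the pulled back operator is a differential operator in arbitrary charts is a separate matter. It
    is settled by transporting charts along the dilation: the transported chart lies in the maximal
    atlas ([atlas_dilated_chart]), and the coefficients of P there serve unchanged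
    ([diff_operator_pullback]). *)

(** [g - f] vanishes near [x], so its increment is o(id) and its differential is 0; then
    [g = f + (g - f)]. *)
Lemma near_eq_differentiable (R : realType) (V W : normedModType R)
    (f g : V -> W) (x : V) :
  {near x, f =1 g} -> differentiable f x -> differentiable g x.
Proof.
move=> fg df.
have k0 : (g - f) \o shift x = cst ((g - f) x) + (\0 : V -> W) +o_ 0 id.
  apply/eqaddoP => e e0; rewrite !nearE /=.
  have fxg : g x = f x by rewrite (nbhs_singleton fg).
  move: fg; rewrite (near_shift 0 x) subr0 => fg; near=> y.
  rewrite -[X in `|X|]/(g (y + x) - f (y + x) - (g x - f x + 0)).
  rewrite fxg subrr addr0 subr0.
  have -> : f (y + x) = g (y + x).
    by have := near fg y; apply.
  by rewrite subrr normr0 mulr_ge0// ltW.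
have dk : differentiable (g - f) x.
  apply/diff_locallyP.
  suff -> : ('d (g - f) x : V -> W) = \0 by split=> //; exact: cst_continuous.
  by apply: diff_unique => //; exact: cst_continuous.
have -> : g = f + (g - f) by rewrite addrC subrK.
exact: differentiableD.
Unshelve. all: by end_near. Qed.

(** * Iterated partial derivatives under scaling of the argument *)

Section Scale.
Variables (R : realType) (n : nat).

Lemma dnbhs0_scale (a : R) : a != 0 -> (fun h => a * h) @ 0^' = (0 : R)^'.
Proof.
have sub (b : R) : b != 0 -> (fun h => b * h) @ 0^' `=>` (0 : R)^'.
  move=> b0 A [e /= e0 eA]; exists (e / `|b|) => /=.
    by rewrite divr_gt0 ?normr_gt0.
  move=> h /=; rewrite sub0r normrN ltr_pdivlMr ?normr_gt0// => hb h0.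
  by apply: eA; rewrite ?mulf_neq0//= sub0r normrN normrM mulrC.
move=> a0; rewrite eqEsubset; split => A; last exact: sub.
move=> /(sub _ (invr_neq0 a0)).
by apply: (@filterS _ (0 : R)^') => h; rewrite /= mulVKf.
Qed.

(** The difference quotient on the left at [h] is [a] times the one on the right at [a * h], and
    [h |-> a * h] preserves the punctured neighbourhoods of 0. Since [f] is arbitrary, the scaling
    rule later applies to entries of [invmx (B y)] and to components of sections without any
    smoothness argument. *)
Lemma derive_scale (a : R) (f : 'rV[R]_n -> R) (x v : 'rV[R]_n) :
  'D_v (fun y => f (a *: y)) x = a * 'D_v f (a *: x).
Proof.
have [->|a0] := eqVneq a 0.
  rewrite mul0r (_ : (fun _ => _) = cst (f 0)) ?derive_cst//.
  by apply/funext => y; rewrite scale0r.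
pose G h := h^-1 *: ((f \o shift (a *: x)) (h *: v) - f (a *: x)).
have GE : (fun h => h^-1 *: (((fun y => f (a *: y)) \o shift x) (h *: v)
    - f (a *: x))) = (fun h => a *: G (a * h)).
  apply/funext => h; rewrite /G /= (scalerDr a (h *: v)) !scalerA.
  by rewrite invfM mulrA mulfV// mul1r.
rewrite /derive GE -/G.
have GsE : (G \o (fun h => a * h)) @ 0^' = G @ 0^'.
  by rewrite -[in RHS](dnbhs0_scale a0).
have [cG|dG] := pselect (cvg (G @ 0^')).
  apply/cvg_lim => //; apply: (@cvgZl_tmp _ _ _ _ _ a (G \o (fun h => a * h))).
  by rewrite GsE.
(* both limits diverge, hence both derivatives are the junk value 0 *)
rewrite [in RHS]dvgP// mulr0 dvgP// => cG'; apply: dG.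
rewrite -GsE (_ : G \o _ = (fun h => a^-1 *: (a *: G (a * h)))).
  exact: is_cvgZl_tmp.
by apply/funext => h; rewrite -[RHS]/(a^-1 * (a * _)) mulKf.
Qed.

Lemma derive_mull (b : R) (f : 'rV[R]_n -> R) (x v : 'rV[R]_n) :
  'D_v (fun y => b * f y) x = b * 'D_v f x.
Proof.
have [->|b0] := eqVneq b 0.
  rewrite mul0r (_ : (fun _ => _) = cst 0) ?derive_cst//.
  by apply/funext => y; rewrite mul0r.
have [df|ndf] := pselect (derivable f x v); first exact: deriveZ.
(* Neither [f] nor, as [b] is invertible, [b * f] is derivable here, so both derivatives take the
   default value 0. *)
rewrite /derive [in RHS]dvgP// mulr0 dvgP// => dbf; apply: ndf.
rewrite (_ : f = b^-1 \*: (fun y => b * f y)); first exact: derivableZ.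
by apply/funext => y /=; rewrite -[_ *: _]/(b^-1 * (b * f y)) mulKf.
Qed.

Lemma partials_scale (a : R) (s : seq 'I_n) (f : 'rV[R]_n -> R) :
  partials s (fun y => f (a *: y)) =
  fun y => a ^+ size s * partials s f (a *: y).
Proof.
elim: s => [|i s IH] /=; first by apply/funext => y; rewrite mul1r.
rewrite IH; apply/funext => y.
rewrite /partial derive_mull (derive_scale _ (partials s f)).
by rewrite mulrA exprSr.
Qed.

(** Spelling a multi-index as a word of length |gamma| reduces [Dmulti] to [partials], where
    induction on the word is available. *)
Definition multi_seq (gamma : 'I_n -> nat) : seq 'I_n :=
  flatten [seq nseq (gamma i) i | i <- enum 'I_n].

Lemma Dmulti_partials (gamma : 'I_n -> nat) (f : 'rV[R]_n -> R) :
  Dmulti gamma f = partials (multi_seq gamma) f.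
Proof.
rewrite /Dmulti /multi_seq /partials; elim: (enum _) => //= i s ->.
by rewrite foldr_cat; elim: (gamma i) => //= k ->.
Qed.

Lemma size_multi_seq (gamma : 'I_n -> nat) :
  size (multi_seq gamma) = mdeg gamma.
Proof.
rewrite size_flatten /shape -map_comp sumnE big_map big_enum /=.
by apply: eq_bigr => i _; rewrite /= size_nseq.
Qed.

Lemma Dmulti_scale (a : R) (gamma : 'I_n -> nat) (f : 'rV[R]_n -> R) x :
  Dmulti gamma (fun y => f (a *: y)) x =
  a ^+ mdeg gamma * Dmulti gamma f (a *: x).
Proof. by rewrite !Dmulti_partials partials_scale size_multi_seq. Qed.

End Scale.

(** * Smooth functions: locality, sums, products, composition *)

Section Smooth.
Variables (R : realType) (n : nat).
Implicit Types (W : set 'rV[R]_n) (f g : 'rV[R]_n -> R).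

Lemma partials_eq_on W s f g : open W -> {in W, f =1 g} ->
  {in W, partials s f =1 partials s g}.
Proof.
move=> oW fg; elim: s => //= i s IH x; rewrite inE => Wx.
apply: near_eq_derive; near=> y; apply: IH; rewrite inE.
near: y; exact: open_nbhs_nbhs.
Unshelve. all: by end_near. Qed.

Lemma partials_rcons s i f : partials (rcons s i) f = partials s (partial i f).
Proof. by rewrite /partials foldr_rcons. Qed.

(** Bounding the order permits induction: the derivative of a product or of a composite again
    involves the original functions, but only to one order less. *)
Definition Cdiff_on (N : nat) W f : Prop :=
  forall s x, (size s <= N)%N -> W x -> differentiable (partials s f) x.

Lemma smooth_onE W f : smooth_on W f <-> forall N, Cdiff_on N W f.
Proof.
split=> [fW N s x _|fW s x]; first exact: fW.
exact: (fW (size s)).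
Qed.

Lemma Cdiff_onS N W f : Cdiff_on N.+1 W f <->
  (forall x, W x -> differentiable f x) /\ forall i, Cdiff_on N W (partial i f).
Proof.
split=> [fW|[f0 fS] s x].
  split=> [x|i s x sN]; first exact: (fW [::]).
  by rewrite -partials_rcons; apply: fW; rewrite size_rcons.
(* The last letter of a word is the first derivative taken, hence the split at the end. *)
case/lastP: s => [_|s i]; first exact: f0.
by rewrite size_rcons partials_rcons; apply: fS.
Qed.

Lemma Cdiff_on_le N W f : Cdiff_on N.+1 W f -> Cdiff_on N W f.
Proof. by move=> fW s x sN; apply: fW; exact: leqW. Qed.

Lemma Cdiff_on_eq N W f g : open W -> {in W, f =1 g} ->
  Cdiff_on N W f -> Cdiff_on N W g.
Proof.
move=> oW fg fW s x sN Wx; apply: (near_eq_differentiable _ (fW s x sN Wx)).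
near=> y; apply: (partials_eq_on _ oW fg); rewrite inE.
near: y; exact: open_nbhs_nbhs.
Unshelve. all: by end_near. Qed.

Lemma smooth_onS W W' f : W `<=` W' -> smooth_on W' f -> smooth_on W f.
Proof. by move=> WW' fW s x /WW'; exact: fW. Qed.

Lemma Cdiff_onD N W f g : open W -> Cdiff_on N W f -> Cdiff_on N W g ->
  Cdiff_on N W (fun x => f x + g x).
Proof.
move=> oW; elim: N f g => [|N IH] f g fW gW.
  case=> // x _ Wx; apply: differentiableD; [exact: (fW [::])|exact: (gW [::])].
have [f0 fS] := (Cdiff_onS _ _ _).1 fW; have [g0 gS] := (Cdiff_onS _ _ _).1 gW.
apply/Cdiff_onS; split=> [x Wx|i].
  by apply: differentiableD; [exact: f0|exact: g0].
apply: (Cdiff_on_eq oW _ (IH _ _ (fS i) (gS i))) => x; rewrite inE => Wx.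
by rewrite /partial deriveD//; apply: diff_derivable; [exact: f0|exact: g0].
Qed.

Lemma Cdiff_on0 N W : Cdiff_on N W (fun=> 0).
Proof.
elim: N => [|N IH]; first by case=> // x _ _; exact: differentiable_cst.
apply/Cdiff_onS; split=> [x _|i]; first exact: differentiable_cst.
rewrite (_ : partial i _ = fun=> 0)//.
by apply/funext => x; rewrite /partial derive_cst.
Qed.

Lemma Cdiff_on_sum N W (I : Type) (r : seq I) (F : I -> 'rV[R]_n -> R) :
  open W -> (forall i, Cdiff_on N W (F i)) ->
  Cdiff_on N W (fun x => \sum_(i <- r) F i x).
Proof.
move=> oW FW; elim: r => [|i r IH].
  by under eq_fun do rewrite big_nil; exact: Cdiff_on0.
by under eq_fun do rewrite big_cons; exact: Cdiff_onD.
Qed.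

Lemma Cdiff_onM N W f g : open W -> Cdiff_on N W f -> Cdiff_on N W g ->
  Cdiff_on N W (fun x => f x * g x).
Proof.
move=> oW; elim: N f g => [|N IH] f g fW gW.
  case=> // x _ Wx; apply: differentiableM; [exact: (fW [::])|exact: (gW [::])].
have [f0 fS] := (Cdiff_onS _ _ _).1 fW; have [g0 gS] := (Cdiff_onS _ _ _).1 gW.
apply/Cdiff_onS; split=> [x Wx|i].
  by apply: differentiableM; [exact: f0|exact: g0].
have := Cdiff_onD oW (IH _ _ (Cdiff_on_le fW) (gS i))
                      (IH _ _ (Cdiff_on_le gW) (fS i)).
apply: Cdiff_on_eq => // x; rewrite inE => Wx.
by rewrite /partial deriveM//; apply: diff_derivable; [exact: f0|exact: g0].
Qed.

Lemma differentiable_rV (V : normedModType R) (F : V -> 'rV[R]_n) (x : V) :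
  (forall j, differentiable (fun y => F y 0 j) x) -> differentiable F x.
Proof.
move=> dF; rewrite (_ : F = \sum_j (fun y => F y 0 j *: delta_mx 0 j)).
  by apply: differentiable_sum => j; exact: differentiableZl.
by apply/funext => y; rewrite fct_sumE -row_sum_delta.
Qed.

Lemma derive_comp_rV (V : normedModType R) (F : V -> 'rV[R]_n) f (x v : V) :
  differentiable F x -> differentiable f (F x) ->
  'D_v (f \o F) x = \sum_j partial j f (F x) * 'D_v (fun y => F y 0 j) x.
Proof.
move=> dF df; rewrite deriveE; last exact: differentiable_comp.
rewrite diff_comp//= -(deriveE _ dF) derive_mx; last exact: diff_derivable.
rewrite [X in 'd f _ X]row_sum_delta linear_sum; apply: eq_bigr => j _.
by rewrite linearZ /= mxE /partial (deriveE (delta_mx 0 j))//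
  -[LHS]/(_ * _) mulrC.
Qed.

End Smooth.

(** By the chain rule a partial derivative of [f \o F] is a sum of products of [partial j f \o F]
    with partial derivatives of [F]; the induction hypothesis, general in [f], treats the first
    factors. *)
Lemma Cdiff_on_comp (R : realType) (n d N : nat) (W : set 'rV[R]_n)
    (W' : set 'rV[R]_d) (F : 'rV[R]_n -> 'rV[R]_d) (f : 'rV[R]_d -> R) :
  open W -> (forall x, W x -> W' (F x)) ->
  (forall j, Cdiff_on N W (fun x => F x 0 j)) -> Cdiff_on N W' f ->
  Cdiff_on N W (f \o F).
Proof.
move=> oW WW'; elim: N f => [|N IH] f FW fW'.
  case=> // x _ Wx; apply: differentiable_comp; last first.
    by apply: (fW' [::]) => //; exact: WW'.
  by apply: differentiable_rV => j; exact: (FW j [::]).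
have [f0 fS] := (Cdiff_onS _ _ _).1 fW'.
have dF x : W x -> differentiable F x.
  by move=> Wx; apply: differentiable_rV => j; exact: (FW j [::]).
apply/Cdiff_onS; split=> [x Wx|i].
  by apply: differentiable_comp; [exact: dF|apply: f0; exact: WW'].
apply: (@Cdiff_on_eq _ _ _ _
  (fun x => \sum_j partial j f (F x) * partial i (fun y => F y 0 j) x)) => //.
  move=> x; rewrite inE => Wx.
  by rewrite [RHS]derive_comp_rV//; [exact: dF|apply: f0; exact: WW'].
apply: Cdiff_on_sum => // j; apply: Cdiff_onM => //.
  apply: IH (fS j) => l; exact: Cdiff_on_le.
by have [] := (Cdiff_onS _ _ _).1 (FW j).
Qed.

Lemma smooth_on_comp (R : realType) (n d : nat) (W : set 'rV[R]_n)
    (W' : set 'rV[R]_d) (F : 'rV[R]_n -> 'rV[R]_d) (f : 'rV[R]_d -> R) :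
  open W -> (forall x, W x -> W' (F x)) ->
  smooth_mx_on W F -> smooth_on W' f -> smooth_on W (f \o F).
Proof.
move=> oW WW' FW /smooth_onE fW'; apply/smooth_onE => N.
apply: Cdiff_on_comp (fW' N) => // j; have /smooth_onE := FW 0 j; exact.
Qed.

Lemma smooth_on_scale (R : realType) (n : nat) (W : set 'rV[R]_n) (a : R) f :
  smooth_on [set a *: x | x in W] f -> smooth_on W (fun x => f (a *: x)).
Proof.
move=> fW s x Wx; rewrite partials_scale.
apply: differentiableZ; apply: differentiable_comp.
  exact: ex_diff.
by apply: fW; exists x.
Qed.

Lemma open_preim (T U : topologicalType) (D : set T) (B : set U) (h : T -> U) :
  open D -> (forall x, D x -> {for x, continuous h}) -> open B ->
  open (D `&` h @^-1` B).
Proof.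
rewrite !openE => oD hc oB x [Dx Bhx].
apply: filterI; first exact: oD.
apply: (hc x Dx); exact: oB.
Qed.

(** * Charts and smooth functions on the manifold *)

Section Charts.
Variables (R : realType) (n : nat) (T : topologicalType) (c : chart R n T).
Hypothesis cc : is_chart c.

Lemma cmapK q : cdom c q -> cinv c (cmap c q) = q.
Proof. by case: cc => _ _ + _ _; exact. Qed.

Lemma cinv_dom x : (cmap c @` cdom c) x -> cdom c (cinv c x).
Proof. by case=> q cq <-; rewrite cmapK. Qed.

Lemma cinvK x : (cmap c @` cdom c) x -> cmap c (cinv c x) = x.
Proof. by case=> q cq <-; rewrite cmapK. Qed.

Lemma open_cmap_image (A : set T) : open A -> A `<=` cdom c ->
  open (cmap c @` A).
Proof.
move=> oA Ac; case: cc => _ oi _ _ ic.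
rewrite (_ : _ @` _ = (cmap c @` cdom c) `&` cinv c @^-1` A).
  exact: open_preim.
apply/seteqP; split=> [x [q Aq <-]|x [cx Ax]].
  by split; [exists q => //; exact: Ac|rewrite /= cmapK//; exact: Ac].
by exists (cinv c x) => //; rewrite cinvK.
Qed.

End Charts.

Section SmoothFun.
Variables (R : realType) (n : nat) (M : manifold R n).

Lemma smooth_funS (W W' : set M) F :
  W `<=` W' -> smooth_fun W' F -> smooth_fun W F.
Proof.
move=> WW' FW c ac; apply: smooth_onS (FW c ac).
by move=> x [q [cq Wq] <-]; exists q => //; split=> //; exact: WW'.
Qed.

Lemma smooth_fun_cmap (c : chart R n M) j : atlas M c ->
  smooth_fun (cdom c) (fun q => cmap c q 0 j).
Proof. by move=> ac d ad; have [+ _] := atlas_compatible ad ac; exact. Qed.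

(** Smoothness need only be checked in the single chart [c]: any other chart differs from it by a
    smooth transition map. *)
Lemma smooth_on_comp_cinv (c : chart R n M) (W : set M) (F : 'rV[R]_n -> R) :
  atlas M c -> open W -> W `<=` cdom c ->
  smooth_on (cmap c @` W) F -> smooth_fun W (F \o cmap c).
Proof.
move=> ac oW Wc FW d ad; have [dc _] := atlas_compatible ad ac.
have [od _ _ _ _] := atlas_chart ad.
apply: (@smooth_on_comp _ _ _ _ (cmap c @` W) (cmap c \o cinv d)) => //.
- apply: (open_cmap_image (atlas_chart ad)); first exact: openI.
  by move=> q [].
- move=> _ [q [dq Wq] <-]; exists q => //=.
  by rewrite (cmapK (atlas_chart ad)).
- move=> i j; apply: smooth_onS (dc i j) => _ [q [dq Wq] <-].
  by exists q => //; split => //; exact: Wc.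
Qed.

End SmoothFun.

(** * The dilation as a local diffeomorphism *)

Section Dilation.
Variables (R : realType) (n : nat) (M : manifold R n) (c : chart R n M) (r : R).
Hypotheses (ac : atlas M c) (cr : cmap c @` cdom c = eball r).

Let cc := atlas_chart ac.

(** This domain treats [a] and [a^-1] alike: it is all of [cdom c] for a contraction, and the image
    of that contraction for the inverse factor. *)
Definition dilation_dom (a : R) : set M :=
  cdom c `&` (cmap c @^-1` [set x | eball r (a *: x)]).

Lemma cmap_eball q : cdom c q -> eball r (cmap c q).
Proof. by move=> cq; rewrite -cr; exists q. Qed.

Lemma cinv_cdom x : eball r x -> cdom c (cinv c x).
Proof. by rewrite -cr; exact: cinv_dom. Qed.

Lemma cinv_eball x : eball r x -> cmap c (cinv c x) = x.
Proof. by rewrite -cr; exact: cinvK. Qed.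

Lemma cmap_dilation a q : dilation_dom a q ->
  cmap c (dilation c a q) = a *: cmap c q.
Proof. by move=> [_ aq]; exact: cinv_eball. Qed.

Lemma cdom_dilation a q : dilation_dom a q -> cdom c (dilation c a q).
Proof. by move=> [_ aq]; exact: cinv_cdom. Qed.

Lemma open_eball : open (eball (R := R) (n := n) r).
Proof. by rewrite -cr; case: cc. Qed.

Lemma open_dilation_dom a : open (dilation_dom a).
Proof.
have [oc _ _ mc _] := cc.
apply: open_preim => //.
rewrite -[X in open X]setTI; apply: open_preim; first exact: openT.
  by move=> x _; exact: scaler_continuous.
exact: open_eball.
Qed.

Lemma dilation_continuous a q : dilation_dom a q ->
  {for q, continuous (dilation c a)}.
Proof.
have [oc _ _ mc ic] := cc => aq; have [cq aqr] := aq.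
apply: (@continuous_comp _ _ _ (fun q => a *: cmap c q) (cinv c)).
  apply: (@continuous_comp _ _ _ (cmap c) ( *:%R a)); first exact: mc.
  exact: scaler_continuous.
by apply: ic; rewrite cr.
Qed.

Lemma dilationK a q : a != 0 -> dilation_dom a q ->
  dilation c a^-1 (dilation c a q) = q.
Proof.
move=> a0 aq; rewrite {1}/dilation cmap_dilation// scalerA mulVf// scale1r.
by rewrite cmapK//; case: aq.
Qed.

Lemma dilation_domV a q : a != 0 -> dilation_dom a q ->
  dilation_dom a^-1 (dilation c a q).
Proof.
move=> a0 aq; split; first exact: cdom_dilation.
rewrite /= cmap_dilation// scalerA mulVf// scale1r.
by apply: cmap_eball; case: aq.
Qed.

Lemma open_dilation_image a (O : set M) : a != 0 -> open O ->
  O `<=` dilation_dom a -> open (dilation c a @` O).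
Proof.
move=> a0 oO Oa.
rewrite (_ : _ @` _ = dilation_dom a^-1 `&` dilation c a^-1 @^-1` O).
  apply: open_preim => //; first exact: open_dilation_dom.
  exact: dilation_continuous.
apply/seteqP; split=> [_ [q Oq <-]|q [aq Oq]].
  by split; [apply: dilation_domV|rewrite /= dilationK] => //; exact: Oa.
exists (dilation c a^-1 q) => //.
by have := @dilationK a^-1 q; rewrite invrK invr_eq0; exact.
Qed.

Lemma smooth_fun_dilation a (W : set M) F : open W -> smooth_fun W F ->
  smooth_fun (dilation_dom a `&` dilation c a @^-1` W) (F \o dilation c a).
Proof.
move=> oW FW; have [oc _ _ _ _] := cc.
have oV : open (dilation_dom a `&` dilation c a @^-1` W).
  apply: open_preim => //; first exact: open_dilation_dom.
  exact: dilation_continuous.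
apply: (@smooth_on_comp_cinv _ _ _ c _ (fun x => F (cinv c (a *: x)))) => //.
  by move=> q [[]].
apply: (@smooth_on_scale _ _ _ _ (F \o cinv c)).
apply: smooth_onS (FW c ac) => _ [_ [q [aq Wq] <-] <-].
exists (dilation c a q); last exact: cmap_dilation.
by split=> //; exact: cdom_dilation.
Qed.

End Dilation.

Section DilatedChart.
Variables (R : realType) (n : nat) (M : manifold R n) (c : chart R n M) (r : R).
Hypotheses (ac : atlas M c) (cr : cmap c @` cdom c = eball r).

Let cc := atlas_chart ac.

(* In this chart, P at a dilated point has the same local expression as the   *)
(* pulled back operator in the chart d, so that by maximality of the atlas no *)
(* change of charts for higher derivatives is needed.                         *)
Definition dilated_chart (a : R) (d : chart R n M) : chart R n M :=
  Chart (dilation c a @` (dilation_dom c r a `&` cdom d))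
        (cmap d \o dilation c a^-1) (dilation c a \o cinv d).

Lemma cmap_dilated_chart a d (A : set M) : a != 0 ->
  A `<=` dilation_dom c r a ->
  cmap (dilated_chart a d) @` (dilation c a @` A) = cmap d @` A.
Proof.
move=> a0 Aa; apply/seteqP; split=> [_ [_ [q Aq <-] <-]|_ [q Aq <-]].
  by exists q => //=; rewrite (dilationK ac cr)//; exact: Aa.
exists (dilation c a q); first by exists q.
by rewrite /= (dilationK ac cr)//; exact: Aa.
Qed.

(** By maximality of the atlas, compatibility with each chart [e] suffices. The transition maps are
    coordinates of [e] composed with the dilation by [a], read in [d], and coordinates of [d]
    composed with the dilation by [a^-1], read in [e]; both are smooth by [smooth_fun_dilation]. *)
Lemma atlas_dilated_chart a d : a != 0 -> atlas M d ->
  atlas M (dilated_chart a d).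
Proof.
move=> a0 ad; have dc := atlas_chart ad; have [od oid _ md ivd] := dc.
have oD : open (dilation_dom c r a `&` cdom d).
  by apply: openI => //; exact: open_dilation_dom.
apply: atlas_maximal.
  split.
  - by apply: (open_dilation_image ac cr) => // q [].
  - rewrite cmap_dilated_chart//.
    by apply: (open_cmap_image dc) => // q [].
  - move=> _ [q [aq dq] <-] /=.
    by rewrite (dilationK ac cr)// (cmapK dc).
  - move=> _ [q [aq dq] <-].
    apply: continuous_comp.
      apply: (dilation_continuous ac cr).
      exact: (dilation_domV ac cr).
    by rewrite (dilationK ac cr)//; exact: md.
  - rewrite cmap_dilated_chart//.
    move=> _ [q [aq dq] <-]; apply: continuous_comp.
      by apply: ivd; exists q.
    by rewrite (cmapK dc)//; exact: (dilation_continuous ac cr).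
move=> e ae; have ec := atlas_chart ae; have [oe _ _ _ _] := ec.
split=> i j; rewrite ord1.
- have := smooth_fun_dilation ac cr (a := a) oe (smooth_fun_cmap j ae) ad.
  apply: smooth_onS => _ [_ [[q [aq dq] <-] eq] <-].
  by exists q => //=; rewrite (dilationK ac cr).
- have aV0 : a^-1 != 0 by rewrite invr_eq0.
  have := smooth_fun_dilation ac cr (a := a^-1) od (smooth_fun_cmap j ad) ae.
  apply: smooth_onS => _ [_ [[q [aq dq] <-] eq] <-].
  exists (dilation c a q) => //; split => //; split.
    exact: (dilation_domV ac cr).
  by rewrite /= (dilationK ac cr).
Qed.

End DilatedChart.

Lemma eball_scale (R : realType) (n : nat) (r a : R) (x : 'rV[R]_n) :
  0 <= a <= 1 -> eball r x -> eball r (a *: x).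
Proof.
move=> /andP[a0 a1]; apply: le_lt_trans.
apply: ler_sum => i _; rewrite mxE exprMn ler_piMl ?sqr_ge0//.
by rewrite exprn_ile1.
Qed.

Lemma dilation_dom_contraction (R : realType) (n : nat) (M : manifold R n)
    (c : chart R n M) (r a : R) :
  cmap c @` cdom c = eball r -> 0 <= a <= 1 -> dilation_dom c r a = cdom c.
Proof.
move=> cr a01; apply/seteqP; split=> q; first by case.
by move=> cq; split => //; apply: eball_scale => //; rewrite -cr; exists q.
Qed.

(** * Jacobians, Christoffel symbols and rays under scaling *)

Section JacobianScale.
Variables (R : realType) (n : nat).

Lemma jacobian_near_scale (F : 'rV[R]_n -> 'rV[R]_n) (a : R) x :
  {near x, F =1 *:%R a} -> 'J F x = a%:M.
Proof.
move=> Fa; have dF : differentiable F x.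
  by apply: (near_eq_differentiable (f := *:%R a)) => //; near do apply/esym.
apply/row_matrixP => i; rewrite !rowE -deriveEjacobian//.
rewrite (near_eq_derive _ Fa) deriveE//.
by rewrite diff_val mul_mx_scalar.
Unshelve. all: by end_near. Qed.

Lemma near_open_eq (T : topologicalType) (U : Type) (W : set T)
    (f g : T -> U) x :
  open W -> W x -> (forall y, W y -> f y = g y) -> {near x, f =1 g}.
Proof.
move=> oW Wx fg; near=> y; apply: fg; near: y; exact: open_nbhs_nbhs.
Unshelve. all: by end_near. Qed.

(** Needed because the rescaled metric is identified with [h (a *: y)] only on the ball. *)
Lemma christoffel_near (h h' : 'rV[R]_n -> 'M[R]_n) k i j x :
  {near x, h =1 h'} -> christoffel h k i j x = christoffel h' k i j x.
Proof.
move=> hh'; have ph l m e : partial l (fun y => h y m e) x =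
    partial l (fun y => h' y m e) x.
  by apply: near_eq_derive; near do congr (fun_of_matrix _ _ _).
rewrite /christoffel (nbhs_singleton hh'); congr (_ * _).
by apply: eq_bigr => l _; rewrite !ph.
Unshelve. all: by end_near. Qed.

Lemma christoffel_scale (h : 'rV[R]_n -> 'M[R]_n) (a : R) k i j x :
  christoffel (fun y => h (a *: y)) k i j x = a * christoffel h k i j (a *: x).
Proof.
have ph l m e : partial l (fun y => h (a *: y) m e) x =
    a * partial l (fun y => h y m e) (a *: x).
  by rewrite /partial (derive_scale a (fun y => h y m e)).
rewrite /christoffel mulrCA; congr (_ * _); rewrite mulr_sumr.
by apply: eq_bigr => l _; rewrite !ph -mulrDr -mulrBr mulrCA.
Qed.

Lemma is_derive_ray (v : 'rV[R]_n) i (t : R) :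
  is_derive t 1 (fun s : R => (s *: v) 0 i) (v 0 i).
Proof.
rewrite (_ : (fun s : R => _) = (fun s => s) * cst (v 0 i)).
  apply: is_derive_eq; rewrite scaler0 add0r.
  by rewrite -[_ *: _]/(_ * _) mulr1.
by apply/funext => s; rewrite mxE.
Qed.

Lemma derive1_ray (v : 'rV[R]_n) i :
  derive1 (fun s : R => (s *: v) 0 i) = cst (v 0 i).
Proof.
apply/funext => t; rewrite derive1E.
by have [_ ->] := is_derive_ray v i t.
Qed.

(** A ray has constant velocity [v] and no acceleration, so the geodesic equation becomes purely
    algebraic. *)
Lemma geodesic_ray (h : 'rV[R]_n -> 'M[R]_n) I v :
  geodesic h I (fun t => t *: v) <->
  forall t k, I t ->
    \sum_i \sum_j christoffel h k i j (t *: v) * v 0 i * v 0 j = 0.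
Proof.
split=> H t k It.
  have [_ _] := H t k It.
  rewrite derive1_ray derive1_cst add0r => H0; apply: etrans H0.
  by apply: eq_bigr => i _; apply: eq_bigr => j _; rewrite !derive1_ray.
split; rewrite ?derive1_ray; first by have [] := is_derive_ray v k t.
- exact: derivable_cst.
- rewrite derive1_cst add0r -[RHS](H t k It).
  by apply: eq_bigr => i _; apply: eq_bigr => j _; rewrite !derive1_ray.
Qed.

End JacobianScale.

(** * Scaling of differential expressions, geometric polynomials and vielbeins *)

Section DiffExpr.
Variables (R : realType) (n m k : nat).
Implicit Types (coef : {ffun 'I_n -> 'I_m.+1} -> 'rV[R]_n -> 'M[R]_k).

Lemma diff_expr_scale coef (u : 'rV[R]_n -> 'rV[R]_k) (a : R) x : a != 0 ->
  diff_expr coef (fun y => u (a^-1 *: y)) (a *: x) =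
  diff_expr (fun gamma y =>
    a ^- mdeg (fun i => gamma i) *: coef gamma (a *: y)) u x.
Proof.
move=> a0; apply: eq_bigr => gamma _.
rewrite -scalemxAr scalemxAl; congr (_ *m _).
apply/rowP => b; rewrite !mxE (Dmulti_scale a^-1 _ (fun y => u y 0 b)).
by rewrite scalerA mulVf// scale1r exprVn.
Qed.

Lemma diff_expr_eq_on (W : set 'rV[R]_n) coef (u v : 'rV[R]_n -> 'rV[R]_k) x :
  open W -> W x -> {in W, u =1 v} -> diff_expr coef u x = diff_expr coef v x.
Proof.
move=> oW Wx uv; apply: eq_bigr => gamma _; congr (_ *m _).
apply/rowP => b; rewrite !mxE !Dmulti_partials.
by apply: (partials_eq_on _ oW); rewrite ?inE// => y Wy; rewrite uv.
Qed.

End DiffExpr.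

Section GeometricScale.
Variables (R : realType) (n : nat).

Lemma gfactor_eval_scale (B : 'rV[R]_n -> 'M[R]_n) (a : R) w x :
  gfactor_eval (fun y => B (a *: y)) w x =
  a ^+ gfactor_order w * gfactor_eval B w (a *: x).
Proof.
case: w => gamma i j /=.
  exact: (Dmulti_scale a _ (fun y => invmx (B y) i j)).
exact: (Dmulti_scale a _ (fun y => B y i j)).
Qed.

(** Homogeneity makes this work: orders in every monomial add up to [N], so each monomial in the
    scaled vielbein carries the same factor [a ^+ N]. The free constant [b] goes into the
    coefficients. *)
Lemma geometric_polynomial_scale (r : R) (B : 'rV[R]_n -> 'M[R]_n) (N : nat)
    (a b : R) (f : 'rV[R]_n -> R) : 0 <= a <= 1 ->
  geometric_polynomial r B N f ->
  geometric_polynomial r (fun y => B (a *: y)) N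
    (fun x => b * (a ^+ N * f (a *: x))).
Proof.
move=> a01 [Q [QN fE]]; exists [seq (b * q.1, q.2) | q <- Q].
split=> [|x xr]; first by rewrite all_map.
rewrite fE; last exact: eball_scale.
rewrite big_map !mulr_sumr; elim: Q QN {fE} => [|q Q IH] /=.
  by rewrite !big_nil.
move=> /andP[/eqP qN QN]; rewrite !big_cons IH//; congr (_ + _).
rewrite -!mulrA; congr (_ * _).
under [in RHS]eq_bigr do rewrite gfactor_eval_scale.
by rewrite big_split /= prodrXr qN mulrCA.
Qed.

Lemma vielbein_scale (h h' : 'rV[R]_n -> 'M[R]_n) (r a : R)
    (B : 'rV[R]_n -> 'M[R]_n) :
  open (eball (R := R) (n := n) r) -> 0 <= a <= 1 ->
  (forall x, eball r x -> h' x = h (a *: x)) ->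
  vielbein h r B -> vielbein h' r (fun x => B (a *: x)).
Proof.
move=> ob a01 hh' [Bs B0 Bh Bp]; split.
- move=> i j; apply: (@smooth_on_scale _ _ _ _ (fun x => B x i j)).
  apply: smooth_onS (Bs i j) => _ [x xr <-]; exact: eball_scale.
- by rewrite scaler0.
- by move=> x xr; rewrite hh'//; apply: Bh; exact: eball_scale.
move=> l v t k tvr.
have rayE s : s *: (a *: v) = a *: (s *: v) by rewrite !scalerA mulrC.
have rE : (fun s : R => row l (B (s *: (a *: v)))) =
    fun s => row l (B (a *: (s *: v))).
  by apply/funext => s; rewrite rayE.
(* Parallelism for [h] is used along the ray of velocity [a *: v] at the same time [t]; this extra
   [a] matches the one in [christoffel_scale]. *)
have := Bp l (a *: v); rewrite rE => /(_ t k); rewrite /= rayE.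
move=> /(_ (eball_scale a01 tvr)).
move=> [dB EB]; split=> //; apply: etrans EB; congr (_ + _).
apply: eq_bigr => i _; apply: eq_bigr => j _; congr (_ * _).
rewrite !derive1_ray /= mxE mulrA; congr (_ * _).
rewrite (christoffel_near (h' := fun y => h (a *: y))).
  by rewrite christoffel_scale mulrC.
exact: (near_open_eq ob).
Qed.

Lemma normal_chart_scale (M : manifold R n) (c : chart R n M) p (r a : R)
    (h h' : 'rV[R]_n -> 'M[R]_n) :
  0 <= a <= 1 ->
  (forall x, eball r x -> h' x = h (a *: x)) ->
  normal_chart c p r h -> normal_chart c p r h'.
Proof.
move=> a01 hh' [[ac r0] [cp p0] cr h0 hg]; split=> //.
  by rewrite hh' ?scaler0//; rewrite -cr -p0; exists p.
move=> v; apply/geodesic_ray => t k tv.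
have atv : eball r (t *: (a *: v)).
  by rewrite scalerA mulrC -scalerA; exact: eball_scale.
(* Here the direction [v] is kept and the time becomes [a * t]; the equation for [h'] is then [a]
   times the one for [h]. *)
have := (geodesic_ray h [set t | eball r (t *: v)] v).1 (hg v).
move=> /(_ (a * t)); rewrite /= -scalerA => /(_ k (eball_scale a01 tv)) H.
transitivity (a * \sum_i \sum_j
    christoffel h k i j (a *: (t *: v)) * v 0 i * v 0 j); last first.
  by rewrite H mulr0.
rewrite mulr_sumr; apply: eq_bigr => i _; rewrite mulr_sumr.
apply: eq_bigr => j _.
have -> : christoffel h' k i j (t *: v) =
    a * christoffel h k i j (a *: (t *: v)).
  rewrite -christoffel_scale; apply: christoffel_near.
  by apply: (near_open_eq (open_eball ac cr)).
by move: (christoffel _ _ _ _ _) => G; rewrite !mulrA.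
Qed.

End GeometricScale.

(** * Sections, operators and connections under the dilation *)

Section DilationSections.
Variables (R : realType) (n k : nat) (M : manifold R n) (E : vbundle k M).
Variables (c : chart R n M) (r : R).
Hypotheses (ac : atlas M c) (cr : cmap c @` cdom c = eball r).

Lemma smooth_section_pushforward (a : R) O (s : M -> E) :
  a != 0 -> open O -> O `<=` dilation_dom c r a ->
  smooth_section (dilation c a) O s ->
  smooth_section id (dilation c a @` O) (s \o dilation c a^-1).
Proof.
move=> a0 oO Oa [sp ss]; split=> [_ [q Oq <-] /=|t tt b].
  by rewrite (dilationK ac cr) ?sp//; exact: Oa.
have oW : open (O `&` dilation c a @^-1` tdom t).
  apply: open_preim => //; last exact: triv_open tt.
  by move=> q /Oa; exact: (dilation_continuous ac cr).
apply: smooth_funS (smooth_fun_dilation ac cr (a := a^-1) oW (ss t tt b)).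
move=> _ [[q Oq <-] tq]; split.
  by apply: (dilation_domV ac cr) => //; exact: Oa.
by rewrite /= (dilationK ac cr)//; exact: Oa.
Qed.

Lemma smooth_section_pullback (a : R) O (s : M -> E) :
  open O -> smooth_section id O s ->
  smooth_section (dilation c a)
    (dilation_dom c r a `&` dilation c a @^-1` O) (s \o dilation c a).
Proof.
move=> oO [sp ss]; split=> [q [_ Oq]|t tt b]; first exact: sp.
have oW : open (O `&` id @^-1` tdom t).
  by apply: openI => //; exact: triv_open tt.
apply: smooth_funS (smooth_fun_dilation ac cr (a := a) oW (ss t tt b)).
by move=> q [[aq Oq] tq].
Qed.

(** The dilated chart gives a dilated point the coordinates that [d] gives the original point. Hence
    the coefficients of [P] in the dilated chart are coefficients of the pulled back operator in
    [d]. *)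
Lemma diff_operator_pullback (a : R) m (P : (M -> E) -> (M -> E)) : a != 0 ->
  diff_operator id setT m P ->
  diff_operator (dilation c a) (dilation_dom c r a) m (pullback_operator c a P).
Proof.
move=> a0 [Pp Pd]; split=> [ O s oO Oa ss q Oq|d t ad tt].
  apply: (Pp _ _ _ _ (smooth_section_pushforward a0 oO Oa ss)) => //.
  exact: (open_dilation_image ac cr).
have dc := atlas_chart ad; have [od _ _ _ _] := dc.
have oD : open (dilation_dom c r a `&` cdom d).
  by apply: openI => //; exact: open_dilation_dom.
have [coef [cs cP]] := Pd _ t (atlas_dilated_chart ac cr a0 ad) tt.
exists coef; split=> [gamma i j| O s oO Oa ss q Oq dq tq].
  apply: smooth_onS (cs gamma i j) => _ [q [dq [aq tq]] <-].
  exists (dilation c a q); first by split=> //; exists q.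
  by rewrite /= (dilationK ac cr).
rewrite /pullback_operator /=.
rewrite (cP _ _ _ _ (smooth_section_pushforward a0 oO Oa ss)) //; first last.
- by exists q => //; split=> //; exact: Oa.
- exact: (open_dilation_image ac cr).
rewrite /= (dilationK ac cr)//; last exact: Oa.
(* The two local representatives agree only where the dilation and its inverse cancel; this set is
   open, so locality of derivatives suffices. *)
apply: (diff_expr_eq_on (W := cmap d @` (dilation_dom c r a `&` cdom d))).
- by apply: (open_cmap_image dc) => // q' [].
- by exists q => //; split=> //; exact: Oa.
- move=> y; rewrite inE => -[q' [aq' dq'] <-] /=.
  by rewrite (cmapK dc)// (dilationK ac cr).
Qed.

Lemma coord_rep_dilation (a : R) x : eball r x -> eball r (a *: x) ->
  coord_rep c (dilation c a) x = a *: x.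
Proof.
by move=> xr axr; rewrite /coord_rep /dilation /= !(cinv_eball ac cr).
Qed.

Lemma near_coord_rep_dilation (a : R) x : 0 <= a <= 1 -> eball r x ->
  {near x, coord_rep c (dilation c a) =1 *:%R a}.
Proof.
move=> a01 xr; apply: (near_open_eq (open_eball ac cr)) => // y yr.
by apply: coord_rep_dilation => //; exact: eball_scale.
Qed.

Lemma near_coord_rep_id x : eball r x -> {near x, coord_rep c id =1 *:%R 1}.
Proof.
move=> xr; apply: (near_open_eq (open_eball ac cr)) => // y yr.
by rewrite /coord_rep /= (cinv_eball ac cr) ?scale1r.
Qed.

(** General in [f], so as to cover both the dilation and, with [a = 1], the identity. *)
Lemma pullback_cform_scale (nabla : connection E) (f : M -> M) (a : R) t x i :
  {near x, coord_rep c f =1 *:%R a} ->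
  pullback_cform nabla c f t x i = a *: cform nabla t c (a *: x) i.
Proof.
move=> fa; rewrite /pullback_cform (jacobian_near_scale fa) (nbhs_singleton fa).
rewrite (bigD1 i)//= big1 ?addr0 => [|j ji]; first by rewrite mxE eqxx.
by rewrite mxE eq_sym (negbTE ji) scale0r.
Qed.

(** The two Jacobians of the pull-back contribute [a ^+ 2], which the conformal factor cancels. *)
Lemma rescaled_gram_scale (g : riemannian_metric M) (a : R) x :
  a != 0 -> 0 <= a <= 1 -> eball r x ->
  rescaled_gram g c a x = gram g c (a *: x).
Proof.
move=> a0 a01 xr; have ca := near_coord_rep_dilation a01 xr.
rewrite /rescaled_gram /pullback_gram (jacobian_near_scale ca).
rewrite (nbhs_singleton ca) tr_scalar_mx mul_scalar_mx mul_mx_scalar !scalerA.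
by rewrite -mulrA -expr2 mulVf ?scale1r// expf_neq0.
Qed.

Lemma parallel_frame_pullback (nabla : connection E) (a : R) p
    (s0 : 'I_k -> E) (s : 'I_k -> M -> E) :
  0 <= a <= 1 -> cdom c p -> cmap c p = 0 ->
  parallel_frame nabla c r p id s0 s ->
  parallel_frame nabla c r p (dilation c a) s0 (fun j => s j \o dilation c a).
Proof.
move=> a01 cp p0 [ss sp sb sP].
have aE := dilation_dom_contraction cr a01.
have adom q : cdom c q -> cdom c (dilation c a q).
  by rewrite -{1}aE => aq; exact: (cdom_dilation ac cr aq).
have [oc _ _ _ _] := atlas_chart ac.
split.
- move=> j; have := smooth_section_pullback a oc (ss j).
  rewrite aE (_ : _ `&` _ = cdom c)//.
  by apply/seteqP; split=> q; [case|move=> cq; split => //; exact: adom].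
- by move=> j; rewrite /= /dilation p0 scaler0 -p0 (cmapK (atlas_chart ac)).
- by move=> q /adom; exact: sb.
move=> j v t tvr tr ttr tv b.
have rayE s' : s' *: (a *: v) = a *: (s' *: v) by rewrite !scalerA mulrC.
have dE s' : eball r (s' *: v) ->
    dilation c a (cinv c (s' *: v)) = cinv c (s' *: (a *: v)).
  by move=> s'r; rewrite /dilation (cinv_eball ac cr)// rayE.
have atv : eball r (t *: (a *: v)) by rewrite rayE; exact: eball_scale.
(* The two curves in [E] coincide only while the ray stays in the ball, which is enough to compare
   derivatives at [t]. *)
have near_t : {near t,
    (fun s' => tcoord tr (s j (cinv c (s' *: (a *: v)))) 0 b) =1
    (fun s' => tcoord tr ((s j \o dilation c a) (cinv c (s' *: v))) 0 b)}.
  apply: (@near_open_eq _ _ ( *:%R^~ v @^-1` eball r)) => //.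
    rewrite -[X in open X]setTI; apply: open_preim; first exact: openT.
      by move=> ? _; exact: scalel_continuous.
    exact: (open_eball ac cr).
  by move=> s' s'r /=; rewrite dE.
move: tv; rewrite /= dE// => tv.
have [dS ES] := sP j (a *: v) t atv tr ttr tv b.
split; first exact: near_eq_derivable dS.
rewrite derive1E -(near_eq_derive _ near_t) -derive1E -[RHS]ES; congr (_ + _).
apply: eq_bigr => i _; rewrite !derive1_ray /= [X in _ = X * _]mxE.
rewrite (pullback_cform_scale _ _ _ (near_coord_rep_dilation a01 tvr)).
rewrite (pullback_cform_scale _ _ _ (near_coord_rep_id atv)).
by rewrite !scale1r -scalemxAr [X in _ * X = _]mxE rayE mulrCA mulrA.
Qed.

End DilationSections.

(** * Assembly of the proof *)

Theorem proposition5p15 (R : realType) (n k m : nat) (M : manifold R n)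
    (g : riemannian_metric M) (E : vbundle k M) (nabla : connection E)
    (p : M) (c : chart R n M) (r : R) (s0 : 'I_k -> E) (lambda : R)
    (P : (M -> E) -> (M -> E)) :
  normal_chart c p r (gram g c) ->
  fibre_basis p s0 ->
  0 < lambda < 1 ->
  diff_operator id setT m P ->
  geometric_operator nabla c p r id s0 (gram g c) m P ->
  diff_operator (dilation c lambda) (cdom c) m (pullback_operator c lambda P) /\
  geometric_operator nabla c p r (dilation c lambda) s0 (rescaled_gram g c lambda) m
    (pullback_operator c lambda P).
Proof.
move=> nc _ /andP[l0 l1] dP [_ [B [s [coef [vB ps geo Pcoef]]]]].
have l01 : 0 <= lambda <= 1 by rewrite !ltW.
have ln0 : lambda != 0 by rewrite gt_eqF.
have [[ac r0] [cp p0] cr _ _] := nc.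
have lE := dilation_dom_contraction cr l01.
have gE x : eball r x -> rescaled_gram g c lambda x = gram g c (lambda *: x).
  exact: (rescaled_gram_scale ac cr).
split; first by rewrite -lE; exact: (diff_operator_pullback ac cr).
split; first exact: (normal_chart_scale l01 gE nc).
exists (fun x => B (lambda *: x)), (fun j => s j \o dilation c lambda),
  (fun (gamma : {ffun 'I_n -> 'I_m.+1}) y =>
    lambda ^- mdeg (fun i => gamma i) *: coef gamma (lambda *: y)); split.
- exact: (vielbein_scale (open_eball ac cr) l01 gE).
- exact: (parallel_frame_pullback ac cr).
- move=> gamma gm a b.
  (* The choice [b = lambda ^- m] works because lambda^-m lambda^(m - |gamma|) = lambda^-|gamma|,
     the factor in the new coefficients. *)
  have := geometric_polynomial_scale (lambda ^- m) l01 (geo gamma gm a b).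
  congr geometric_polynomial; apply/funext => x; rewrite mxE mulrA.
  congr (_ * _); rewrite -[X in lambda ^- X](subnK gm) exprD invfM mulrC mulrA.
  by rewrite mulfV ?mul1r// expf_neq0.
move=> O sigma u oO Oc ss su q Oq.
have Ol : O `<=` dilation_dom c r lambda by rewrite lE.
rewrite -diff_expr_scale// -(cmap_dilation ac cr (Ol _ Oq)).
have lq := Ol _ Oq.
(* The local formula for [P] is applied to the section pushed forward to the dilated open set, whose
   components in the original frame are [u (lambda^-1 *: y)]. *)
have := Pcoef (dilation c lambda @` O) (sigma \o dilation c lambda^-1)
  (fun y => u (lambda^-1 *: y)).
have H q' : (dilation c lambda @` O) q' -> has_components id s q'
  ((sigma \o dilation c lambda^-1) q') (u (lambda^-1 *: cmap c q')).
  move=> [q0 Oq0 <-]; have lq0 := Ol _ Oq0.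
  rewrite /= (dilationK ac cr)// (cmap_dilation ac cr)//.
  by rewrite scalerA mulVf// scale1r; exact: (su q0 Oq0).
move=> /(_ _ _ _ H (dilation c lambda q)); apply.
- exact: (open_dilation_image ac cr).
- by move=> _ [q0 Oq0 <-]; apply: (cdom_dilation ac cr); exact: Ol.
- exact: (smooth_section_pushforward ac cr).
- by exists q.
Qed.
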